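(* Let $n\in\{2,3\}$, $\mu,\kappa,k>0$ and $\widehat{k}>\frac18$. Then the Cauchy-stress–logarithmic-strain relation of the exponentiated Hencky energy, $$\sigma_{\rm eH}:\mathrm{Sym}(n)\to\mathrm{Sym}(n),\qquad \sigma_{\rm eH}(X)=2\mu\,e^{k\|\mathrm{dev}_n X\|^2-\mathrm{tr}(X)}\,\mathrm{dev}_n X+\kappa\,e^{\widehat{k}[\mathrm{tr}(X)]^2-\mathrm{tr}(X)}\,\mathrm{tr}(X)\, I ,$$ is invertible: for every $\sigma\in\mathrm{Sym}(n)$ there is exactly one $X\in\mathrm{Sym}(n)$ with $\sigma_{\rm eH}(X)=\sigma$.
   Context: $\mathrm{Sym}(n)$ is the space of real symmetric $n\times n$ matrices, $I$ the identity matrix, $\|X\|^2=\mathrm{tr}(XX^T)$ and $\mathrm{dev}_nX=X-\frac1n\mathrm{tr}(X)I$. Here $X=\log V$, where $V=\sqrt{FF^T}$ is the left stretch tensor, and $\sigma_{\rm eH}=e^{-\mathrm{tr}(\log V)}D_{\log V}W_{\rm eH}(\log V)$ is the Cauchy stress of the energy $W_{\rm eH}(\log V)=\frac{\mu}{k}e^{k\|\mathrm{dev}_n\log V\|^2}+\frac{\kappa}{2\widehat{k}}e^{\widehat{k}(\mathrm{tr}\log V)^2}$. *)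

(* Defs.v *)
From HB Require Import structures.
From mathcomp Require Import all_boot all_order all_algebra.
From mathcomp Require Import all_classical all_reals all_analysis.

Set Implicit Arguments.
Unset Strict Implicit.
Unset Printing Implicit Defensive.

Import Order.TTheory GRing.Theory Num.Theory.

Local Open Scope ring_scope.

(* The squared Frobenius norm, ||X||^2 = tr (X X^T). *)
Definition normsq (R : realType) (n : nat) (X : 'M[R]_n) : R :=
  \tr (X *m X^T).

Definition dev (R : realType) (n : nat) (X : 'M[R]_n) : 'M[R]_n :=
  X - (n%:R^-1 * \tr X) *: 1%:M.

(* The Cauchy stress of the exponentiated Hencky energy
     W (X) = mu / k * e^(k ||dev X||^2) + kappa / (2 khat) * e^(khat (tr X)^2)
   as a function of the logarithmic strain X = log V, i.e. the explicit form of
   e^(- tr X) * DW (X). *)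
Definition sigma_eH (R : realType) (n : nat) (mu kappa k khat : R)
    (X : 'M[R]_n) : 'M[R]_n :=
  (2 * mu * expR (k * normsq (dev X) - \tr X)) *: dev X
  + (kappa * expR (khat * (\tr X) ^+ 2 - \tr X) * \tr X) *: 1%:M.

(* Main.v *)
Require Import Defs.
From HB Require Import structures.
From mathcomp Require Import all_boot all_order all_algebra.
From mathcomp Require Import all_classical all_reals all_analysis.
From mathcomp Require Import ring lra.

Set Implicit Arguments.
Unset Strict Implicit.
Unset Printing Implicit Defensive.

Import Order.TTheory GRing.Theory Num.Theory.

Local Open Scope ring_scope.

(** The trace and the deviator of the stress separate the unknowns.  With
    [t = \tr X] and [D = dev X], the equation [sigma_eH X = S] says
      [n * kappa * t * e^(khat t^2 - t) = \tr S]  and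
      [2 mu e^(k |D|^2 - t) D = dev S],
    so one first solves a scalar equation for [t], and then, with [t] known, a
    radial equation [e^(k |D|^2) D = B] for [D].

    The radial equation forces [D = s B], where [s = e^(- k |D|^2)] satisfies
    [s * e^(k |B|^2 s^2) = 1]: it is again a scalar equation.  Both scalar
    functions have the form [t * e^(a t^2 - c t)], whose derivative is the
    exponential times [1 - c t + 2 a t^2].  If this quadratic is positive
    everywhere, the function is a bijection of the line (lemma
    [mul_expR_quad_bij]).  For the trace, [a = khat] and [c = 1], and positivity
    of the quadratic is the condition [1 < 8 khat]; for the deviator,
    [a = k |B|^2] and [c = 0], and it is obvious. *)

Lemma is_derive_mul_expR_quad (R : realType) (a c t : R) :
  is_derive t 1 (fun t => t * expR (a * t ^+ 2 - c * t))
    (expR (a * t ^+ 2 - c * t) * (1 - c * t + 2 * a * t ^+ 2)).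
Proof.
pose q (t : R) := a * t ^+ 2 - c * t.
have dq : is_derive t 1 q (2 * a * t - c).
  have -> : q = (a *: (@id R ^+ 2) - c *: @id R).
    by apply/funext => x; rewrite /q !fctE.
  by apply: is_derive_eq; rewrite /GRing.scale/=; ring.
have de : is_derive t 1 (expR \o q) (expR (q t) * (2 * a * t - c)).
  by apply: is_derive_eq; rewrite /GRing.scale/=; ring.
have -> : (fun t => t * expR (a * t ^+ 2 - c * t)) = (@id R * (expR \o q)).
  by apply/funext.
by apply: is_derive_eq; rewrite /GRing.scale/= -/(q t); ring.
Qed.

Lemma mul_expR_quad_lt (R : realType) (a c : R) :
  (forall t, 0 < 1 - c * t + 2 * a * t ^+ 2) ->
  {homo (fun t => t * expR (a * t ^+ 2 - c * t)) : x y / x < y}.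
Proof.
move=> q_gt0 x y xy; have dg := @is_derive_mul_expR_quad R a c.
have xl : x \in `[x, y] by rewrite in_itv/= lexx ltW.
have yl : y \in `[x, y] by rewrite in_itv/= lexx ltW.
pose g t := t * expR (a * t ^+ 2 - c * t).
suff g_homo : {in `[x, y] &, {homo g : x y / x < y}} by exact: g_homo.
apply: gtr0_derive1_lt_cc => [t _|t _|].
- by have [] := dg t.
- by rewrite derive1E (@derive_val _ _ _ _ _ _ _ (dg t)) mulr_gt0 ?expR_gt0.
- by apply: derivable_within_continuous => t _; have [] := dg t.
Qed.

(** Positivity of the derivative gives injectivity.  It also gives
    surjectivity: at [t / 2] the hypothesis reads [- 2 < a t^2 - c t], so the
    function dominates [t * e^-2] in absolute value and is unbounded in both
    directions. *)
Lemma mul_expR_quad_bij (R : realType) (a c y : R) :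
  (forall t, 0 < 1 - c * t + 2 * a * t ^+ 2) ->
  exists! t, t * expR (a * t ^+ 2 - c * t) = y.
Proof.
move=> q_gt0; pose g t := t * expR (a * t ^+ 2 - c * t).
have g_inj t u : g t = g u -> t = u.
  have g_lt : {homo g : x y / x < y} by exact: mul_expR_quad_lt.
  by move=> gE; case: (ltgtP t u) => // /g_lt; rewrite gE ltxx.
have exp_ge t : expR (-2) <= expR (a * t ^+ 2 - c * t).
  by rewrite ler_expR; have := q_gt0 (t / 2); rewrite expr_div_n; lra.
pose M := `|y| * expR 2.
have M_ge0 : 0 <= M by rewrite mulr_ge0 ?expR_ge0.
have yE : `|y| = M * expR (-2) by rewrite /M -mulrA -expRD subrr expR0 mulr1.
have [gNM gM] : g (- M) <= - `|y| /\ `|y| <= g M.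
  by rewrite yE /g mulNr lerN2; split; exact: ler_wpM2l.
have [t _ gt] : exists2 t, t \in `[- M, M] & g t = y.
  apply: IVT.
  - by rewrite ge0_cp.
  - apply: derivable_within_continuous => t _.
    by have [] := is_derive_mul_expR_quad a c t.
  - have /andP[yl yu] : - `|y| <= y <= `|y| by rewrite -ler_norml.
    by rewrite ge_min le_max (le_trans gNM yl) (le_trans yu gM) orbT.
by exists t; split=> // u gu; apply: g_inj; rewrite gt.
Qed.

Lemma symmetricmxP (R : realType) (n : nat) (A : 'M[R]_n) :
  reflect (A^T = A) (A \is symmetricmx).
Proof.
by rewrite is_hermitianmxE expr0 scale1r map_mx_id // eq_sym; exact: eqP.
Qed.

Lemma normsqZ (R : realType) (n : nat) (a : R) (A : 'M[R]_n) :
  normsq (a *: A) = a ^+ 2 * normsq A.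
Proof.
by rewrite /normsq linearZ/= -scalemxAl -scalemxAr !mxtraceZ mulrA -expr2.
Qed.

Lemma normsq_ge0 (R : realType) (n : nat) (A : 'M[R]_n) :
  0 <= normsq A.
Proof.
rewrite /normsq /mxtrace sumr_ge0 // => i _; rewrite mxE sumr_ge0 // => j _.
by rewrite mxE -expr2 sqr_ge0.
Qed.

(** The solution is [s *: B] with [s] the solution of [s * e^(k |B|^2 s^2) = 1];
    solving for the factor [s] instead of the norm of [D] avoids dividing by
    [|B|], so that [B = 0] is no exception. *)
Lemma radial_expR_bij (R : realType) (n : nat) (k : R) (B : 'M[R]_n) :
  0 <= k ->
  exists! D, expR (k * normsq D) *: D = B.
Proof.
move=> k_ge0; pose a := k * normsq B.
have a_ge0 : 0 <= a by rewrite mulr_ge0 ?normsq_ge0.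
have [s [sE s_uniq]] : exists! s, s * expR (a * s ^+ 2 - 0 * s) = 1.
  apply: mul_expR_quad_bij => t; rewrite mul0r subr0 -mulrA ltr_pwDl//.
  by rewrite mulr_ge0// mulr_ge0 ?sqr_ge0.
exists (s *: B); split.
  have -> : k * normsq (s *: B) = a * s ^+ 2 - 0 * s.
    by rewrite normsqZ /a; ring.
  by rewrite scalerA mulrC sE scale1r.
move=> D DE; pose r := expR (- (k * normsq D)).
have DrB : D = r *: B by rewrite -DE scalerA -expRD addrC subrr expR0 scale1r.
rewrite [RHS]DrB; congr (_ *: _); apply: s_uniq.
have -> : a * r ^+ 2 - 0 * r = k * normsq D.
  by rewrite [in RHS]DrB normsqZ /a; ring.
by rewrite -expRD addrC subrr expR0.
Qed.

Lemma mxtrace_dev (R : realType) (n : nat) (X : 'M[R]_n) :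
  (0 < n)%N -> \tr (dev X) = 0.
Proof.
move=> n_gt0; have n_neq0 : n%:R != 0 :> R by rewrite pnatr_eq0 -lt0n.
by rewrite /dev raddfB/= mxtraceZ mxtrace1 mulrAC mulVf ?mul1r ?subrr.
Qed.

Lemma mxtrace_add_scalar (R : realType) (n : nat) (D : 'M[R]_n) (b : R) :
  \tr D = 0 -> \tr (D + b *: 1%:M) = b * n%:R.
Proof. by move=> D0; rewrite mxtraceD mxtraceZ mxtrace1 D0 add0r. Qed.

Lemma dev_add_scalar (R : realType) (n : nat) (D : 'M[R]_n) (b : R) :
  (0 < n)%N -> \tr D = 0 -> dev (D + b *: 1%:M) = D.
Proof.
move=> n_gt0 D0; have n_neq0 : n%:R != 0 :> R by rewrite pnatr_eq0 -lt0n.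
by rewrite /dev mxtrace_add_scalar// mulrC mulfK// addrK.
Qed.

Lemma dev_decomp (R : realType) (n : nat) (X : 'M[R]_n) :
  X = dev X + (n%:R^-1 * \tr X) *: 1%:M.
Proof. by rewrite subrK. Qed.

Lemma symmetric_add_scalar (R : realType) (n : nat) (D : 'M[R]_n) (b : R) :
  D \is symmetricmx ->
  D + b *: 1%:M \is symmetricmx.
Proof.
move=> /symmetricmxP D_sym; apply/symmetricmxP.
by rewrite linearD linearZ/= trmx1 D_sym.
Qed.

Lemma symmetric_scale (R : realType) (n : nat) (a : R) (A : 'M[R]_n) :
  A \is symmetricmx -> a *: A \is symmetricmx.
Proof.
move=> /symmetricmxP A_sym; apply/symmetricmxP.
by rewrite linearZ/= A_sym.
Qed.

Lemma symmetric_dev (R : realType) (n : nat) (X : 'M[R]_n) :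
  X \is symmetricmx -> dev X \is symmetricmx.
Proof. by rewrite /dev -scaleNr; exact: symmetric_add_scalar. Qed.

Theorem mainTheorem2 (R : realType) (n : nat) (mu kappa k khat : R)
    (hn : n = 2%N \/ n = 3%N)
    (hmu : 0 < mu) (hkappa : 0 < kappa) (hk : 0 < k) (hkhat : 1 / 8 < khat) :
  (forall X : 'M[R]_n,
     X \is symmetricmx -> sigma_eH mu kappa k khat X \is symmetricmx) /\
  (forall S : 'M[R]_n, S \is symmetricmx ->
     exists! X : 'M[R]_n, X \is symmetricmx /\ sigma_eH mu kappa k khat X = S).
Proof.
have n_gt0 : (0 < n)%N by case: hn => ->.
have n_neq0 : n%:R != 0 :> R by rewrite pnatr_eq0 -lt0n.
split=> [X X_sym|S S_sym].
  by apply/symmetric_add_scalar/symmetric_scale/symmetric_dev.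
pose c t := 2 * mu * expR (- t).
have c_neq0 t : c t != 0 by rewrite gt_eqF// !mulr_gt0 ?expR_gt0.
have sigmaE (X : 'M[R]_n) : sigma_eH mu kappa k khat X =
    c (\tr X) *: (expR (k * normsq (dev X)) *: dev X)
    + (kappa * (\tr X * expR (khat * (\tr X) ^+ 2 - 1 * \tr X))) *: 1%:M.
  rewrite /sigma_eH scalerA expRD mul1r; congr (_ *: _ + _ *: _); rewrite /c; ring.
have tr0 (X : 'M[R]_n) (a b : R) : \tr (a *: (b *: dev X)) = 0.
  by rewrite !mxtraceZ mxtrace_dev// !mulr0.
have [t [tE t_uniq]] :
    exists! t, t * expR (khat * t ^+ 2 - 1 * t) = (kappa * n%:R)^-1 * \tr S.
  apply: mul_expR_quad_bij => t.
  (* Completing the square; the coefficient of t^2 left over is positive by hkhat. *)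
  have -> : 1 - 1 * t + 2 * khat * t ^+ 2 =
      (1 - t / 2) ^+ 2 + 2 * (khat - 1 / 8) * t ^+ 2 by field.
  have [->|t_neq0] := eqVneq t 0; first by lra.
  have t2_gt0 : 0 < t ^+ 2 by rewrite exprn_even_gt0.
  by rewrite ltr_wpDl ?sqr_ge0// mulr_gt0//; lra.
have [D [DE D_uniq]] := radial_expR_bij ((c t)^-1 *: dev S) (ltW hk).
have D_sc : D = expR (- (k * normsq D)) *: ((c t)^-1 *: dev S).
  by rewrite -DE scalerA -expRD addrC subrr expR0 scale1r.
have D_tr : \tr D = 0 by rewrite D_sc tr0.
exists (D + (n%:R^-1 * t) *: 1%:M); split; first split.
- apply: symmetric_add_scalar; rewrite D_sc.
  by do 2!apply: symmetric_scale; exact: symmetric_dev.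
- rewrite sigmaE dev_add_scalar// mxtrace_add_scalar// mulrC mulVKf// tE.
  rewrite DE scalerKV// [RHS]dev_decomp; congr (_ + _ *: _).
  by field; rewrite n_neq0 gt_eqF.
- move=> X [_ XS]; have trX : \tr X = t.
    symmetry; apply: t_uniq.
    rewrite -XS sigmaE mxtrace_add_scalar//; field.
    by rewrite n_neq0 gt_eqF.
  have devX : dev X = D.
    symmetry; apply: D_uniq.
    by rewrite -XS [in RHS]sigmaE dev_add_scalar// trX scalerK.
  by rewrite [RHS]dev_decomp devX trX.
Qed.
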